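(* Let $F$ be a quasi-finite field of characteristic $p>0$, with algebraic closure $F^a$. Assume $F$ does not contain the field $\bigcup_{n\in\mathbb N}\mathbb F_{p^{p^n}}\subseteq F^a$ (the maximal abelian $p$-extension of the prime field $\mathbb F_p$). Then $p$ is not geometrically represented in $\mathrm{Th}(F)$.
   Context: A field $F$ is quasi-finite if it is perfect and, for every integer $n\ge1$, has exactly one extension of degree $n$ inside $F^a$. For a complete theory $T$ (here in the language of rings), a prime $p$ is geometrically represented in $T$ if there exist models $M_0\prec M\models T$ and substructures $M_0\le A\le B\le M$ with $B\subseteq \mathrm{acl}(A)$ such that $\mathrm{Aut}(B/A)\cong \mathbb Z/p\mathbb Z$; here $\mathrm{Aut}(B/A)$ denotes the group of permutations of $B$ fixing $A$ pointwise and preserving the truth value (computed in $M$) of every first-order formula with parameters from $B$. *)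

(* Defs.v *)
From HB Require Import structures.
From mathcomp Require Import all_boot all_algebra all_field.
From mathcomp Require Import boolp classical_sets cardinality.

Set Implicit Arguments.
Unset Strict Implicit.
Unset Printing Implicit Defensive.

Import GRing.Theory.

Local Open Scope classical_set_scope.
Local Open Scope ring_scope.

(* [GRing.formula R] is not used: its terms contain all elements of [R] as
   constants, and an inversion symbol.  Here a formula of type [rformula n]
   is parameter-free and has its free variables among [n] variables. *)

Inductive rterm (n : nat) : Type :=
| TVar of 'I_n
| TZero
| TOne
| TAdd of rterm n & rterm n
| TOpp of rterm n
| TMul of rterm n & rterm n.

Inductive rformula (n : nat) : Type :=
| FEq of rterm n & rterm n
| FFalse
| FNot of rformula n
| FAnd of rformula n & rformula n
| FOr of rformula n & rformula n
| FImp of rformula n & rformula n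
| FAll of rformula n.+1
| FEx of rformula n.+1.

Arguments TZero {n}.
Arguments TOne {n}.
Arguments FFalse {n}.

Record rstruct := RStruct {
  rs_sort :> Type;
  rs_zero : rs_sort;
  rs_one : rs_sort;
  rs_add : rs_sort -> rs_sort -> rs_sort;
  rs_opp : rs_sort -> rs_sort;
  rs_mul : rs_sort -> rs_sort -> rs_sort }.

Definition ring_rstruct (R : pzRingType) : rstruct :=
  @RStruct R 0 1 +%R -%R *%R.

(* A quantifier binds variable [ord0]; variable [i] of the context becomes
   variable [lift ord0 i] under it. *)
Definition env_cons (X : Type) (n : nat) (a : X) (v : 'I_n -> X)
    (i : 'I_n.+1) : X :=
  if unlift ord0 i is Some j then v j else a.

Section Semantics.
Variable M : rstruct.

Fixpoint teval (n : nat) (t : rterm n) (v : 'I_n -> M) : M :=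
  match t with
  | TVar i => v i
  | TZero => rs_zero M
  | TOne => rs_one M
  | TAdd t1 t2 => rs_add (teval t1 v) (teval t2 v)
  | TOpp t1 => rs_opp (teval t1 v)
  | TMul t1 t2 => rs_mul (teval t1 v) (teval t2 v)
  end.

Fixpoint sat (n : nat) (f : rformula n) : ('I_n -> M) -> Prop :=
  match f with
  | FEq t1 t2 => fun v => teval t1 v = teval t2 v
  | FFalse => fun _ => False
  | FNot f1 => fun v => ~ sat f1 v
  | FAnd f1 f2 => fun v => sat f1 v /\ sat f2 v
  | FOr f1 f2 => fun v => sat f1 v \/ sat f2 v
  | FImp f1 f2 => fun v => sat f1 v -> sat f2 v
  | FAll f1 => fun v => forall a : M, sat f1 (env_cons a v)
  | FEx f1 => fun v => exists a : M, sat f1 (env_cons a v)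
  end.

(* There are no variables to assign: the value [rs_zero M] is never used. *)
Definition models (f : rformula 0) : Prop := sat f (fun=> rs_zero M).

Definition Th : set (rformula 0) := [set f | models f].

Definition models_theory (T : set (rformula 0)) : Prop :=
  forall f, T f -> models f.

Record substruct := Substruct {
  ss_set :> set M;
  ss_zero : ss_set (rs_zero M);
  ss_one : ss_set (rs_one M);
  ss_add : forall x y, ss_set x -> ss_set y -> ss_set (rs_add x y);
  ss_opp : forall x, ss_set x -> ss_set (rs_opp x);
  ss_mul : forall x y, ss_set x -> ss_set y -> ss_set (rs_mul x y) }.

Definition in_subset (A : set M) (x : M) (h : A x) : set_type A :=
  exist (fun y => y \in A) x (mem_set h).

Definition induced_rstruct (A : substruct) : rstruct :=
  @RStruct (set_type A)
    (in_subset (ss_zero A))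
    (in_subset (ss_one A))
    (fun x y => in_subset (ss_add (set_mem (valP x)) (set_mem (valP y))))
    (fun x => in_subset (ss_opp (set_mem (valP x))))
    (fun x y => in_subset (ss_mul (set_mem (valP x)) (set_mem (valP y)))).

(* [b] satisfies a formula with parameters in [A] (variable [ord0] is the
   free one) that has only finitely many solutions in [M]. *)
Definition acl (A : set M) : set M :=
  [set b | exists (n : nat) (f : rformula n.+1) (a : 'I_n -> M),
     [/\ forall i, A (a i),
         sat f (env_cons b a)
       & finite_set [set x : M | sat f (env_cons x a)]]].

Definition elem_aut (A B : set M) : set (set_type B -> set_type B) :=
  [set s : set_type B -> set_type B | [/\ bijective s,
     forall x : set_type B, A (val x) -> s x = x
   & forall (n : nat) (f : rformula n) (b : 'I_n -> set_type B),
       sat f (fun i => val (b i)) <-> sat f (fun i => val (s (b i)))]].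

(* ['Z_p] is Z/pZ only for [1 < p]. *)
Definition elem_aut_isog_Zp (A B : set M) (p : nat) : Prop :=
  exists h : 'Z_p -> (set_type B -> set_type B),
    [/\ injective h,
        range h = @elem_aut A B
      & forall i j : 'Z_p, h (i + j) = h i \o h j].

End Semantics.

Definition elementary_substruct (M : rstruct) (M0 : substruct M) : Prop :=
  forall (n : nat) (f : rformula n) (v : 'I_n -> induced_rstruct M0),
    sat f v <-> @sat M n f (fun i => val (v i)).

Definition geometrically_represented (T : set (rformula 0)) (p : nat) : Prop :=
  exists (M : rstruct) (M0 A B : substruct M),
    [/\ models_theory M T, elementary_substruct M0,
        [/\ M0 `<=` A, A `<=` B & B `<=` acl A]
      & elem_aut_isog_Zp A B p].

Definition is_subfield (E : fieldType) (K : set E) : Prop :=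
  divring_closed [pred x | x \in K].

Definition is_algebraic_closure (F : fieldType) (Fa : closedFieldType)
    (iota : {rmorphism F -> Fa}) : Prop :=
  forall x : Fa, algebraicOver iota x.

Definition perfect_field (F : fieldType) : Prop :=
  forall q : {poly F}, irreducible_poly q -> separable_poly q.

Definition extension_of_degree (F E : fieldType) (iota : {rmorphism F -> E})
    (n : nat) (K : set E) : Prop :=
  [/\ is_subfield K,
      range iota `<=` K
    & exists b : 'I_n -> E, (forall i, K (b i)) /\
        forall x, K x ->
          exists! c : {ffun 'I_n -> F}, x = \sum_(i < n) iota (c i) * b i].

Definition quasi_finite (F : fieldType) (Fa : closedFieldType)
    (iota : {rmorphism F -> Fa}) : Prop :=
  perfect_field F /\
  forall n : nat, (0 < n)%N -> exists! K : set Fa, extension_of_degree iota n K.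

(* The subfield with [q] elements: there is at most one in [E]. *)
Definition finite_subfield (E : fieldType) (q : nat) : set E :=
  [set x | exists K : set E, [/\ is_subfield K, (K #= `I_q)%card & K x]].
Arguments finite_subfield : clear implicits.

Definition max_abelian_pext (E : fieldType) (p : nat) : set E :=
  \bigcup_(n in [set: nat]) finite_subfield E (p ^ (p ^ n))%N.
Arguments max_abelian_pext : clear implicits.

(* Main.v *)
Require Import Defs.
From HB Require Import structures.
From mathcomp Require Import all_boot all_algebra all_field finmap.
From mathcomp Require Import boolp classical_sets cardinality.

Set Implicit Arguments.
Unset Strict Implicit.
Unset Printing Implicit Defensive.

Import GRing.Theory.

Local Open Scope classical_set_scope.
Local Open Scope ring_scope.

(* Write P y := y ^+ p - y.  On Fa, P is Frobenius minus the identity, so P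
   iterated p ^ n times kills the field with p ^ (p ^ n) elements; were P onto
   F, descending along P would put all these fields inside F.  So some a in F
   is not of the form P y, and uniqueness of the extension of degree p makes F
   the union of the cosets t * a + P(F), t in the prime field.  This is a
   first-order property of F, so it also holds in M, which is a field, for some
   a in M0.
   An elementary map s of B of order p over A has (s - 1)^p = s^p - 1 = 0, so
   there are u, v in B with s u = u + v and s v = v != 0.  Then c := u / v is
   sent to c + 1; as s preserves the coset of a * c modulo P(M), a would be in
   P(M). *)

Lemma exprBn_pchar (R : comNzRingType) (x y : R) n :
  [pchar R].-nat n -> (x - y) ^+ n = x ^+ n - y ^+ n.
Proof. by move=> pcharn; rewrite exprDn_pchar // exprNn_pchar. Qed.

Lemma coef_exp_XaddC (R : comNzRingType) (a : R) m n :
  (('X + a%:P) ^+ m)`_n = a ^+ (m - n) *+ 'C(m, n).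
Proof.
rewrite addrC exprDn (eq_bigr (fun i : 'I_m.+1 =>
  (a ^+ (m - i) *+ 'C(m, i)) *: 'X^i)) => [|i _]; last first.
  by rewrite -mulrnAl -mul_polyC polyCMn polyC_exp.
rewrite -(poly_def _ (fun i => a ^+ (m - i) *+ 'C(m, i))) coef_poly ltnS.
by case: leqP => // /bin_small->.
Qed.

Lemma expr_size_mul_stable (R : idomainType) (x : R) (s : seq R) :
  uniq s -> 0 \notin s -> x != 0 -> {in s, forall y, x * y \in s} ->
  x ^+ size s = 1.
Proof.
move=> uniq_s s0 nz_x xs.
have uniq_xs : uniq [seq x * y | y <- s].
  by rewrite map_inj_uniq //; apply: mulfI.
have perm_xs : perm_eq [seq x * y | y <- s] s.
  have [||_ eq_xs] := uniq_min_size uniq_xs (s2 := s); rewrite ?size_map //.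
    by move=> _ /mapP[y ys ->]; apply: xs.
  exact: uniq_perm.
have /mulIf : \prod_(y <- s) y != 0.
  by rewrite prodf_seq_neq0; apply/allP => y ys; apply: contraNneq s0 => <-.
apply; rewrite mul1r -[in RHS](perm_big _ perm_xs) big_map big_split /=.
by rewrite big_const_seq count_predT iter_mulr_1.
Qed.

Lemma finite_subfield_expr (E : fieldType) n (x : E) :
  finite_subfield E n x -> x ^+ n = x.
Proof.
move=> [K [[K1 KB KV] cardK Kx]].
have memK : fset_set K =i [pred y | y \in K].
  by move=> y; rewrite in_fset_set //; exists n.
have KM : {in K &, forall y z, y * z \in K}.
  move=> y z Ky Kz; rewrite -[z]invrK; apply: (KV _ _ Ky).
  by have := KV _ _ K1 Kz; rewrite div1r.
have card_n := card_fset_set cardK.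
have K0 : 0 \in fset_set K by rewrite memK -(subrr 1); apply: KB.
have n_eq : n = (size (fset_set K `\ 0)%fset).+1.
  by rewrite -card_n (cardfsD1 0) K0.
have [-> | nz_x] := eqVneq x 0; first by rewrite n_eq expr0n.
pose s : seq E := (fset_set K `\ 0)%fset.
have xs1 : x ^+ size s = 1.
  apply: expr_size_mul_stable => //; rewrite ?fset_uniq ?in_fsetD1 ?eqxx //.
  move=> y; rewrite !in_fsetD1 !memK => /andP[nz_y Ky].
  by rewrite mulf_neq0 //; apply: KM; rewrite // inE.
by rewrite n_eq exprS xs1 mulr1.
Qed.

Lemma pchar_fixed_natr (F : fieldType) p (x : F) :
  p \in [pchar F] -> x ^+ p = x -> exists n, x = n%:R.
Proof.
move=> pcharF xp; have p_prime := pcharf_prime pcharF.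
pose Fp : comUnitAlgType 'F_p := pPrimeCharType pcharF.
have := congr1 (map_poly (in_alg Fp)) (finField_genPoly 'F_p).
rewrite card_Fp // rmorphB /= map_polyXn map_polyX rmorph_prod /=.
rewrite (eq_bigr (fun y : 'F_p => 'X - (y%:R : F)%:P)) => [|y _]; last first.
  rewrite rmorphB /= map_polyX map_polyC /=; congr (_ - _%:P); exact: mulr1.
move/(congr1 (root^~ x)).
rewrite -(big_map (fun y : 'F_p => y%:R : F) xpredT (fun z => 'X - z%:P)).
rewrite root_prod_XsubC /root !hornerE xp subrr eqxx => /esym/mapP[y _ ->].
by exists y.
Qed.

Section DifferenceOperator.
Variables (R : comNzRingType) (T : Type) (f d : T -> T) (h : T -> R).
Hypothesis h_difference : forall y, h (d y) = h (f y) - h y.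
Hypothesis difference_commutes : forall y, f (d y) = d (f y).
Variable N : nat.
Hypothesis pcharN : [pchar R].-nat N.

(* The functional ['X^k |-> h (iter k f x)] turns [d] into multiplication by
   ['X - 1], whose [N]-th power is ['X^N - 1]. *)
Lemma iter_difference_pchar x : h (iter N d x) = h (iter N f x) - h x.
Proof.
pose L (q : {poly R}) := \sum_(k < N.+1) q`_k * h (iter k f x).
have LB q r : L (q - r) = L q - L r.
  by rewrite -sumrB; apply: eq_bigr => k _; rewrite coefB mulrBl.
have LX j : (j <= N)%N -> L 'X^j = h (iter j f x).
  rewrite -ltnS => ltjN; rewrite /L (bigD1 (Ordinal ltjN)) //= coefXn eqxx.
  rewrite mul1r big1 ?addr0 // => k /negPf; rewrite -val_eqE /= => k_neq_j.
  by rewrite coefXn k_neq_j mul0r.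
have iter_commutes j y : iter j f (d y) = d (iter j f y).
  by elim: j => //= j ->; rewrite difference_commutes.
have LXB n j : (j + n <= N)%N ->
    h (iter j f (iter n d x)) = L ('X^j * ('X - 1) ^+ n).
  elim: n j => [|n IHn] j; first by rewrite addn0 mulr1 => /LX.
  move=> lejn; rewrite iterS iter_commutes h_difference -iterS.
  rewrite !IHn ?(leq_trans _ lejn) ?addSnnS ?leq_add2l //.
  by rewrite -LB exprSr [in RHS]exprS mulrBl mul1r mulrBr mulrA.
have pcharNX : [pchar {poly R}].-nat N by rewrite (eq_pnat _ (pchar_poly R)).
rewrite -[iter N d x]/(iter 0 f _) LXB // mul1r exprBn_pchar // expr1n.
by rewrite -(expr0 'X) LB !LX.
Qed.

Lemma exists_unipotent_pair x : injective h ->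
  iter N f x = x -> f x <> x ->
  exists u v : T, [/\ h v <> 0, f v = v & h (f u) = h u + h v].
Proof.
move=> h_inj fNx fx.
have [N0 | N_gt0] := posnP N; first by move: pcharN; rewrite N0.
have ex_kill : exists m, h (iter m.+1 d x) == 0.
  by exists N.-1; rewrite prednK // iter_difference_pchar fNx subrr.
have f_fixed y : h (d y) == 0 -> f y = y.
  by rewrite h_difference subr_eq0 => /eqP/h_inj.
case: (ex_minnP ex_kill) => -[|m] kill min_m; first by case: fx; apply: f_fixed.
exists (iter m d x), (iter m.+1 d x); split.
- by move/eqP/min_m; rewrite ltnn.
- exact: f_fixed.
- by rewrite iterS h_difference addrC subrK.
Qed.

End DifferenceOperator.

Section SimpleExtension.
Variables (F E : fieldType) (iota : {rmorphism F -> E}).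

Definition adjoin (b : E) : set E :=
  range (fun r : {poly F} => (map_poly iota r).[b]).

Lemma adjoin_generator b : adjoin b b.
Proof. by exists 'X; rewrite ?map_polyX ?hornerX. Qed.

Variables (q : {poly F}) (b : E).

Lemma irreducible_poly_min_root :
  (1 < size q)%N -> root (map_poly iota q) b ->
  (forall r, r != 0 -> root (map_poly iota r) b -> (size q <= size r)%N) ->
  irreducible_poly q.
Proof.
move=> q_gt1 qb q_min; split=> // g g_neq1 g_dvd.
have nz_q : q != 0 by rewrite -size_poly_gt0 ltnW.
rewrite -dvdp_size_eqp // eqn_leq dvdp_leq //=.
have /dvdpP[h qE] := g_dvd.
have [nz_h nz_g] : h != 0 /\ g != 0.
  by apply/andP; rewrite -negb_or -mulf_eq0 -qE.
have : root (map_poly iota h) b || root (map_poly iota g) b.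
  by rewrite -rootM -rmorphM -qE.
case/orP => [hb | /q_min->] //.
have := q_min h nz_h hb; rewrite {1}qE size_mul // -ltnS.
rewrite prednK ?ltn_addr ?size_poly_gt0 // -[(size h).+1]addn1 leq_add2l.
by rewrite leq_eqVlt (negPf g_neq1) ltnS leqn0 size_poly_eq0 (negPf nz_g).
Qed.

Hypothesis qb : root (map_poly iota q) b.

Lemma horner_modp_root (r : {poly F}) :
  (map_poly iota (r %% q)).[b] = (map_poly iota r).[b].
Proof.
rewrite [in RHS](divp_eq r q) rmorphD rmorphM hornerD hornerM (eqP qb).
by rewrite mulr0 add0r.
Qed.

Lemma adjoin_small x : q != 0 -> adjoin b x ->
  exists2 r : {poly F}, (size r < size q)%N & (map_poly iota r).[b] = x.
Proof.
move=> nz_q [r _ <-]; exists (r %% q); first by rewrite ltn_modp.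
exact: horner_modp_root.
Qed.

Hypothesis irr_q : irreducible_poly q.

Lemma root_irreducible_dvdp (r : {poly F}) :
  ((map_poly iota r).[b] == 0) = (q %| r).
Proof.
apply/idP/idP => [rb | /modp_eq0P rq]; last first.
  by rewrite -horner_modp_root rq rmorph0 horner0.
apply/idPn; rewrite -(irreducible_poly_coprime r irr_q) -(coprimep_map iota).
by move/coprimep_root/(_ qb)/negP.
Qed.

Lemma adjoin_is_subfield : is_subfield (adjoin b).
Proof.
split=> [|x y|x y]; rewrite !inE.
- by exists 1; rewrite ?rmorph1 ?hornerC.
- move=> [r _ <-] [s _ <-]; exists (r - s) => //.
  by rewrite rmorphB hornerD hornerN.
move=> [r _ <-] [s _ <-].
have [s0 | nz_s] := eqVneq (map_poly iota s).[b] 0.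
  by exists 0 => //; rewrite rmorph0 horner0 s0 invr0 mulr0.
have : coprimep q s.
  by rewrite irreducible_poly_coprime // -root_irreducible_dvdp.
case/Bezout_eq1_coprimepP => -[u v] /= /(congr1 (map_poly iota)).
move/(congr1 (horner^~ b)); rewrite rmorphD !rmorphM rmorph1 hornerD.
rewrite !hornerM (eqP qb) mulr0 add0r hornerC.
move=> vs1; exists (r * v) => //; rewrite rmorphM hornerM; congr (_ * _).
by apply: (mulIf nz_s); rewrite vs1 mulVf.
Qed.

Lemma adjoin_extension_of_degree n :
  size q = n.+1 -> extension_of_degree iota n (adjoin b).
Proof.
move=> size_q; split; first exact: adjoin_is_subfield.
  by move=> _ [a _ <-]; exists a%:P; rewrite ?map_polyC ?hornerC.
have nz_q : q != 0 by rewrite -size_poly_eq0 size_q.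
have size_modq (r : {poly F}) : (size (r %% q)%R <= n)%N.
  by rewrite -ltnS -size_q ltn_modp.
have horner_wide (r : {poly F}) : (size r <= n)%N ->
    (map_poly iota r).[b] = \sum_(i < n) iota r`_i * b ^+ i.
  move=> le_rn; rewrite (@horner_coef_wide _ n) ?size_map_poly //.
  by apply: eq_bigr => i _; rewrite coef_map.
exists (fun i => b ^+ i); split=> [i | _ [r _ <-]].
  by exists 'X^i; rewrite ?map_polyXn ?hornerXn.
exists [ffun i : 'I_n => (r %% q)`_i]; split.
  rewrite -horner_modp_root horner_wide //.
  by apply: eq_bigr => i _; rewrite ffunE.
move=> c; pose s := \poly_(i < n) oapp c 0 (insub i).
have s_coef (i : 'I_n) : s`_i = c i by rewrite coef_poly ltn_ord valK.
have -> : \sum_(i < n) iota (c i) * b ^+ i = (map_poly iota s).[b].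
  rewrite horner_wide ?size_poly //.
  by apply: eq_bigr => i _; rewrite s_coef.
move/eqP; rewrite -subr_eq0 -hornerN -hornerD -rmorphB root_irreducible_dvdp.
move/modp_eq0P/eqP; rewrite modpD modpN subr_eq0 => /eqP rs.
apply/ffunP => i; rewrite ffunE rs modp_small ?s_coef //.
by rewrite size_q ltnS size_poly.
Qed.

End SimpleExtension.

Definition artin_schreier (R : comNzRingType) p (x : R) : R := x ^+ p - x.

Lemma artin_schreierB (R : comNzRingType) p (x y : R) : p \in [pchar R] ->
  artin_schreier p (x - y) = artin_schreier p x - artin_schreier p y.
Proof.
move=> pcharR; rewrite /artin_schreier exprBn_pchar.
  by rewrite !opprD !opprK addrACA.
by rewrite pnatE ?(pcharf_prime pcharR).
Qed.

(* [t ^+ p = t] says that [t] lies in the prime field. *)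
Definition artin_schreier_span (R : comNzRingType) p (a : R) : set R :=
  [set x | exists y t : R, t ^+ p = t /\ x = artin_schreier p y + t * a].

Definition artin_schreier_generator (R : comNzRingType) p (a : R) : Prop :=
  ~ range (artin_schreier p) a /\ forall x, artin_schreier_span p a x.

Definition artin_schreier_poly (F : fieldType) p (a : F) : {poly F} :=
  'X^p - 'X - a%:P.

Lemma size_artin_schreier_poly (F : fieldType) p (a : F) : (1 < p)%N ->
  size (artin_schreier_poly p a) = p.+1.
Proof.
move=> p_gt1; rewrite /artin_schreier_poly -addrA -opprD size_polyDl.
  exact: size_polyXn.
by rewrite size_polyXn size_polyN size_XaddC.
Qed.

Lemma root_map_artin_schreier_poly (F E : fieldType) (iota : {rmorphism F -> E})
    p (a : F) (x : E) :
  root (map_poly iota (artin_schreier_poly p a)) x =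
    (artin_schreier p x == iota a).
Proof.
rewrite !rmorphB /= map_polyXn map_polyX map_polyC /root !hornerE.
exact: subr_eq0.
Qed.

Section TwistedFrobenius.
Variables (F : fieldType) (p : nat) (a : F).
Hypothesis pcharF : p \in [pchar F].

(* The Frobenius of [F[X] / (X^p - X - a)], where [X ^+ p = X + a], lifted to
   polynomials without raising their degree. *)
Definition twisted_frobenius (g : {poly F}) : {poly F} :=
  map_poly (pFrobenius_aut pcharF) g \Po ('X + a%:P).

Lemma size_twisted_frobenius g : size (twisted_frobenius g) = size g.
Proof. by rewrite size_comp_poly2 ?size_XaddC // size_map_poly. Qed.

Lemma coef_twisted_frobenius (g : {poly F}) m n : (size g <= n)%N ->
  (twisted_frobenius g)`_m =
    \sum_(i < n) g`_i ^+ p * (a ^+ (i - m) *+ 'C(i, m)).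
Proof.
move=> le_gn; have p_prime := pcharf_prime pcharF.
rewrite coef_comp_poly size_map_poly.
under eq_bigr do rewrite coef_map /= pFrobenius_autE coef_exp_XaddC.
rewrite (big_ord_widen n (fun i => g`_i ^+ p * (a ^+ (i - m) *+ 'C(i, m)))) //.
rewrite big_mkcond; apply: eq_bigr => i _; case: ltnP => // le_gi.
by rewrite nth_default // expr0n gtn_eqF ?mul0r // prime_gt0.
Qed.

Lemma twisted_frobenius_coef_top (g : {poly F}) m : (size g <= m.+1)%N ->
  (twisted_frobenius g)`_m = g`_m ^+ p.
Proof.
move=> le_gm; rewrite (coef_twisted_frobenius _ le_gm) big_ord_recr /=.
rewrite big1 => [|i _].
  by rewrite add0r subnn binn mulr1.
by rewrite bin_small // mulr0.
Qed.

Lemma twisted_frobenius_coef_subtop (g : {poly F}) m : (size g <= m.+2)%N ->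
  (twisted_frobenius g)`_m = g`_m ^+ p + a * (g`_m.+1 ^+ p *+ m.+1).
Proof.
move=> le_gm; rewrite (coef_twisted_frobenius _ le_gm) !big_ord_recr /=.
rewrite big1 => [|i _].
  by rewrite add0r subnn binn mulr1 subSnn binSn expr1 mulrnAr mulrC -mulrnAr.
by rewrite bin_small // mulr0.
Qed.

Lemma size_twisted_frobenius_sub (g : {poly F}) : g \is monic ->
  (size (twisted_frobenius g - g)%R < size g)%N.
Proof.
move=> g_monic; have nz_g := monic_neq0 g_monic.
rewrite (polySpred nz_g) ltnS; apply/leq_sizeP => j.
rewrite leq_eqVlt coefB => /predU1P[<- | ltj].
  rewrite twisted_frobenius_coef_top -?(polySpred nz_g) //.
  by rewrite -lead_coefE (eqP g_monic) expr1n subrr.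
by rewrite !nth_default ?subrr ?size_twisted_frobenius // polySpred.
Qed.

Lemma twisted_frobenius_fixed_top (g : {poly F}) m :
  ~ range (artin_schreier p) a -> (m.+1 < p)%N -> (size g <= m.+2)%N ->
  (twisted_frobenius g)`_m = g`_m -> (twisted_frobenius g)`_m.+1 = g`_m.+1 ->
  g`_m.+1 = 0.
Proof.
move=> a_notin ltmp le_gm; rewrite twisted_frobenius_coef_subtop //.
rewrite (twisted_frobenius_coef_top le_gm) => + topE; rewrite topE => subtopE.
apply: contra_notP a_notin => /eqP nz_top.
have nz_m : m.+1%:R != 0 :> F by rewrite -(dvdn_pcharf pcharF) gtnNdvd.
pose t := g`_m.+1 *+ m.+1.
have nz_t : t != 0 by rewrite /t -mulr_natr mulf_neq0.
exists (- (g`_m / t)) => //.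
have tp : t ^+ p = t.
  by rewrite -pFrobenius_autE rmorphMn /= pFrobenius_autE topE.
rewrite /artin_schreier exprNn_pchar ?pnatE ?(pcharf_prime pcharF) //.
rewrite expr_div_n tp opprK addrC -mulrBl -[X in X - _]subtopE.
by rewrite [_ ^+ p + _]addrC addrK mulfK.
Qed.

(* Comparing the two top coefficients, [r] has degree at most one. *)
Lemma twisted_frobenius_translate (r : {poly F}) (x : F) :
  ~ range (artin_schreier p) a -> (size r <= p)%N ->
  twisted_frobenius r = r + x%:P ->
  artin_schreier_span p a x.
Proof.
move=> a_notin le_rp rE.
have r_lin : (size r <= 2)%N.
  rewrite leqNgt; apply/negP => lt2r.
  case size_r: (size r) lt2r le_rp => [|[|[|m]]] // _ ltmp.
  have : r`_m.+2 = 0.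
    apply: twisted_frobenius_fixed_top; rewrite ?size_r // rE coefD coefC;
      exact: addr0.
  move/eqP; rewrite -[m.+2]/(m.+3.-1) -size_r -lead_coefE lead_coef_eq0.
  by rewrite -size_poly_eq0 size_r.
have r1_fixed : r`_1 ^+ p = r`_1.
  by rewrite -twisted_frobenius_coef_top // rE coefD coefC addr0.
exists r`_0, r`_1; split=> //.
have := twisted_frobenius_coef_subtop r_lin; rewrite rE coefD coefC r1_fixed.
by move=> r0E; rewrite /artin_schreier addrAC [_ * a]mulrC -r0E addrC addKr.
Qed.

Variables (E : fieldType) (iota : {rmorphism F -> E}) (b : E).
Hypothesis root_b : artin_schreier p b = iota a.

Lemma horner_twisted_frobenius g :
  (map_poly iota (twisted_frobenius g)).[b] = (map_poly iota g).[b] ^+ p.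
Proof.
have pcharE : p \in [pchar E] by rewrite (rmorph_pchar iota).
rewrite map_comp_poly horner_comp rmorphD /= map_polyX map_polyC !hornerE.
rewrite [X in b + X](esym root_b) /artin_schreier addrC subrK -map_poly_comp.
rewrite -!(pFrobenius_autE pcharE) -horner_map -map_poly_comp; congr _.[_].
by apply: eq_map_poly => z /=; rewrite !pFrobenius_autE rmorphXn.
Qed.

Hypothesis a_notin : ~ range (artin_schreier p) a.

(* The twisted Frobenius fixes the monic polynomial of least degree killing [b]:
   the difference would be a smaller one. *)
Lemma artin_schreier_root_free (g : {poly F}) :
  (size g <= p)%N -> (map_poly iota g).[b] = 0 -> g = 0.
Proof.
have [n] := ubnP (size g); elim: n g => // n IHn g.
rewrite ltnS => le_gn le_gp gb.
apply/eqP/idPn => nz_g; pose h : {poly F} := (lead_coef g)^-1 *: g.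
have h_monic : h \is monic by rewrite monicE lead_coefZ mulVf ?lead_coef_eq0.
have size_h : size h = size g by rewrite size_scale // invr_eq0 lead_coef_eq0.
have hb : (map_poly iota h).[b] = 0 by rewrite map_polyZ hornerZ gb mulr0.
have h_fixed : twisted_frobenius h = h.
  have := size_twisted_frobenius_sub h_monic; rewrite size_h => size_dif.
  apply/eqP; rewrite -subr_eq0; apply/eqP/IHn.
  - exact: leq_trans size_dif le_gn.
  - exact: leq_trans (ltnW size_dif) le_gp.
  rewrite rmorphB hornerD hornerN horner_twisted_frobenius hb.
  by rewrite expr0n gtn_eqF ?subrr // prime_gt0 // (pcharf_prime pcharF).
have h_gt1 : (1 < size h)%N.
  rewrite ltnNge; apply/negP => /size1_polyC hC; move: h_monic hb.
  rewrite hC monicE lead_coefC map_polyC hornerC => /eqP-> /eqP.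
  by rewrite fmorph_eq0 oner_eq0.
rewrite -size_h in le_gp; move: h_monic; rewrite monicE lead_coefE.
case size_hE: (size h) h_gt1 le_gp => [|[|m]] //= _ ltmp /eqP lead_h.
have : h`_m.+1 = 0.
  by apply: twisted_frobenius_fixed_top => //; rewrite ?size_hE ?h_fixed.
by rewrite lead_h => /eqP; rewrite oner_eq0.
Qed.

Lemma artin_schreier_irreducible : irreducible_poly (artin_schreier_poly p a).
Proof.
have p_gt1 := prime_gt1 (pcharf_prime pcharF).
have size_q := size_artin_schreier_poly a p_gt1.
apply: (irreducible_poly_min_root (iota := iota) (b := b)) => [||g nz_g gb].
- by rewrite size_q ltnS ltnW.
- by rewrite root_map_artin_schreier_poly root_b.
rewrite size_q ltnNge; apply: contra_neqN nz_g => le_gp.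
exact: artin_schreier_root_free le_gp (eqP gb).
Qed.

Lemma adjoin_artin_schreier_span (x : F) (c : E) :
  artin_schreier p c = iota x -> adjoin iota b c ->
  artin_schreier_span p a x.
Proof.
move=> cx; have p_gt1 := prime_gt1 (pcharf_prime pcharF).
have size_q := size_artin_schreier_poly a p_gt1.
have qb : root (map_poly iota (artin_schreier_poly p a)) b.
  by rewrite root_map_artin_schreier_poly root_b.
have nz_q : artin_schreier_poly p a != 0 by rewrite -size_poly_eq0 size_q.
case/(adjoin_small qb nz_q) => r; rewrite size_q ltnS => le_rp rc.
apply: (twisted_frobenius_translate a_notin le_rp); apply/eqP.
rewrite -subr_eq0; apply/eqP/artin_schreier_root_free.
  rewrite (leq_trans (size_polyD _ _)) // size_polyN size_twisted_frobenius.
  rewrite geq_max le_rp (leq_trans (size_polyD _ _)) // geq_max le_rp.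
  by rewrite (leq_trans (size_polyC_leq1 _)) // ltnW.
rewrite rmorphB rmorphD hornerD hornerN hornerD horner_twisted_frobenius /=.
by rewrite map_polyC hornerC rc /= -cx /artin_schreier [c + _]addrC subrK subrr.
Qed.

End TwistedFrobenius.

Lemma quasi_finite_artin_schreier_span (F : fieldType) (Fa : closedFieldType)
    (iota : {rmorphism F -> Fa}) p (a : F) :
  p \in [pchar F] -> quasi_finite iota -> ~ range (artin_schreier p) a ->
  forall x : F, artin_schreier_span p a x.
Proof.
move=> pcharF [_ uniq_ext] a_notin x; have p_prime := pcharf_prime pcharF.
have p_gt1 := prime_gt1 p_prime.
have [K [_ uniqK]] := uniq_ext p (prime_gt0 p_prime).
have [[y _ <-] | x_notin] := pselect (range (artin_schreier p) x).
  by exists y, 0; rewrite expr0n gtn_eqF ?prime_gt0 // mul0r addr0.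
have rootFa (z : F) :
    exists b, root (map_poly iota (artin_schreier_poly p z)) b.
  apply/closed_rootP; rewrite size_map_poly size_artin_schreier_poly //.
  by rewrite eqSS gtn_eqF // prime_gt0.
have adjoinE (z : F) b : ~ range (artin_schreier p) z ->
    root (map_poly iota (artin_schreier_poly p z)) b -> K = adjoin iota b.
  move=> z_notin zb; apply: uniqK; apply: (adjoin_extension_of_degree zb).
    move: zb; rewrite root_map_artin_schreier_poly => /eqP bz.
    exact: artin_schreier_irreducible bz z_notin.
  exact: size_artin_schreier_poly.
have [b root_b] := rootFa a; have [c root_c] := rootFa x.
move: (root_b) (root_c); rewrite !root_map_artin_schreier_poly.
move=> /eqP b_a /eqP c_x.
apply: (adjoin_artin_schreier_span _ b_a a_notin c_x) => //.
by rewrite -(adjoinE a b) // (adjoinE x c) //; apply: adjoin_generator.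
Qed.

Lemma max_abelian_pext_sub_range (F E : fieldType)
    (iota : {rmorphism F -> E}) p :
  p \in [pchar F] -> range (artin_schreier p : F -> F) = setT ->
  max_abelian_pext E p `<=` range iota.
Proof.
move=> pcharF surj x [n _ /finite_subfield_expr xq].
have pcharE : p \in [pchar E] by rewrite (rmorph_pchar iota).
have range_preimage y : range iota (artin_schreier p y) -> range iota y.
  move=> [a _ ay]; have [z _ za] : range (artin_schreier p) a by rewrite surj.
  have [|m ym] := @pchar_fixed_natr _ p (y - iota z) pcharE.
    apply/eqP; rewrite -subr_eq0 -[X in X == _]/(artin_schreier p _).
    rewrite artin_schreierB // -ay -za /artin_schreier.
    by rewrite rmorphB rmorphXn subrr.
  by exists (m%:R + z) => //; rewrite rmorphD rmorph_nat -ym subrK.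
have descent k y : range iota (iter k (artin_schreier p) y) -> range iota y.
  by elim: k y => // k IHk y; rewrite iterSr => /IHk/range_preimage.
apply: (descent (p ^ n)%N); exists 0 => //; rewrite rmorph0.
rewrite (@iter_difference_pchar _ _ (pFrobenius_aut pcharE) _ id).
- have iter_frob k : iter k (pFrobenius_aut pcharE) x = x ^+ (p ^ k).
    by elim: k => //= k ->; rewrite pFrobenius_autE -exprM -expnSr.
  by rewrite iter_frob xq subrr.
- by move=> y; rewrite pFrobenius_autE.
- by move=> y; rewrite /artin_schreier rmorphB rmorphXn.
by rewrite pnatX pnatE ?(pcharf_prime pcharF) // pcharE.
Qed.

Lemma exists_artin_schreier_generator (F : fieldType) (Fa : closedFieldType)
    (iota : {rmorphism F -> Fa}) p :
  p \in [pchar F] -> quasi_finite iota ->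
  ~ (max_abelian_pext Fa p `<=` range iota) ->
  exists a : F, artin_schreier_generator p a.
Proof.
move=> pcharF qfF; apply: contra_notP => no_generator.
apply: max_abelian_pext_sub_range => //; apply/seteqP; split=> // a _.
apply: contrapT => a_notin; apply: no_generator; exists a; split=> //.
exact: quasi_finite_artin_schreier_span qfF a_notin.
Qed.

Section EnvCons.
Variables (X : Type) (n : nat).
Implicit Types (a : X) (v : 'I_n -> X).

Lemma env_cons0 a v : env_cons a v ord0 = a.
Proof. by rewrite /env_cons unlift_none. Qed.

Lemma env_consS a v i : env_cons a v (lift ord0 i) = v i.
Proof. by rewrite /env_cons liftK. Qed.

Lemma env_cons_eta (w : 'I_n.+1 -> X) :
  env_cons (w ord0) (fun i => w (lift ord0 i)) = w.
Proof. by apply/funext => i; rewrite /env_cons; case: unliftP => [j|] ->. Qed.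

End EnvCons.

Definition env_consE := (env_cons0, env_consS).

Arguments env_cons : simpl never.

Lemma env_cons_comp (X Y : Type) (f : X -> Y) n (a : X) (v : 'I_n -> X) :
  (fun i => f (env_cons a v i)) = env_cons (f a) (fun i => f (v i)).
Proof. by apply/funext => i; rewrite /env_cons; case: unliftP. Qed.

Lemma env_empty_eq (X : Type) (v w : 'I_0 -> X) : v = w.
Proof. by apply/funext => -[]. Qed.

Lemma env_cons_empty (X : Type) (a : X) (v : 'I_0 -> X) :
  env_cons a v = fun=> a.
Proof. by apply/funext => i; rewrite ord1 env_cons0. Qed.

Lemma elementary_substruct_witness (M : rstruct) (M0 : substruct M)
    (f : rformula 1) :
  elementary_substruct M0 -> models M (FEx f) ->
  exists2 a : M, ss_set M0 a & sat f (fun=> a).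
Proof.
move=> elemM0 Mf.
have [_ []] := elemM0 0 (FEx f) (fun=> rs_zero (induced_rstruct M0)).
  by rewrite [X in sat _ X](env_empty_eq _ (fun=> rs_zero M)).
move=> a /elemM0; rewrite env_cons_empty => fa.
by exists (val a); first exact: set_mem (valP a).
Qed.

Local Notation x0 := (TVar ord0).
Local Notation x1 := (TVar (lift ord0 ord0)).
Local Notation x2 := (TVar (lift ord0 (lift ord0 ord0))).
Local Notation x3 := (TVar (lift ord0 (lift ord0 (lift ord0 ord0)))).
Local Notation x4 :=
  (TVar (lift ord0 (lift ord0 (lift ord0 (lift ord0 ord0))))).

Section Terms.
Variable n : nat.
Implicit Type t : rterm n.

Definition natr_term k : rterm n := iter k (TAdd TOne) TZero.

Definition exp_term t k : rterm n := iter k (TMul t) TOne.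

Definition artin_schreier_term p t := TAdd (exp_term t p) (TOpp t).

Lemma teval_natr_term (R : pzRingType) k (v : 'I_n -> ring_rstruct R) :
  teval (natr_term k) v = k%:R.
Proof. by elim: k => //= k ->; rewrite -[RHS]natr1 addrC. Qed.

Lemma teval_exp_term (R : pzRingType) t k (v : 'I_n -> ring_rstruct R) :
  teval (exp_term t k) v = (teval t v : R) ^+ k.
Proof. by elim: k => //= k ->; rewrite exprS. Qed.

End Terms.

Lemma models_theory_valid (M N : rstruct) : models_theory M (Th N) ->
  forall n (f : rformula n), (forall v : 'I_n -> N, sat f v) ->
  forall v : 'I_n -> M, sat f v.
Proof.
move=> MN; elim=> [|n IHn] f fN v.
  by rewrite (env_empty_eq v (fun=> rs_zero M)); apply: MN; apply: fN.
rewrite -(env_cons_eta v); apply: (IHn (FAll f)) => w a; exact: fN.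
Qed.

Lemma rstruct_eta (M : rstruct) :
  M = RStruct (rs_zero M) (rs_one M) (@rs_add M) (@rs_opp M) (@rs_mul M).
Proof. by case: M. Qed.

Lemma models_theory_comNzRing (R : comNzRingType) (M : rstruct) :
  models_theory M (Th (ring_rstruct R)) ->
  exists S : comNzRingType, M = ring_rstruct S.
Proof.
move=> MR; pose var i (lti : (i < 3)%N) : rterm 3 := TVar (Ordinal lti).
pose X := var 0 isT; pose Y := var 1%N isT; pose Z := var 2%N isT.
have transfer (x y z : M) (t u : rterm 3) (v := nth x [:: x; y; z]) :
    (forall w : 'I_3 -> ring_rstruct R, teval t w = teval u w) ->
    teval t (fun i => v i) = teval u (fun i => v i).
  move=> eq_tu; pose w (i : 'I_3) := v i.
  exact: (models_theory_valid MR (f := FEq t u) eq_tu w).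
have addA : associative (@rs_add M) := fun x y z =>
  transfer x y z (TAdd X (TAdd Y Z)) (TAdd (TAdd X Y) Z) (fun=> addrA _ _ _).
have addC : commutative (@rs_add M) := fun x y =>
  transfer x y x (TAdd X Y) (TAdd Y X) (fun=> addrC _ _).
have add0 : left_id (rs_zero M) (@rs_add M) := fun x =>
  transfer x x x (TAdd TZero X) X (fun=> add0r _).
have addN : left_inverse (rs_zero M) (@rs_opp M) (@rs_add M) := fun x =>
  transfer x x x (TAdd (TOpp X) X) TZero (fun=> addNr _).
have mulA : associative (@rs_mul M) := fun x y z =>
  transfer x y z (TMul X (TMul Y Z)) (TMul (TMul X Y) Z) (fun=> mulrA _ _ _).
have mulC : commutative (@rs_mul M) := fun x y =>
  transfer x y x (TMul X Y) (TMul Y X) (fun=> mulrC _ _).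
have mul1 : left_id (rs_one M) (@rs_mul M) := fun x =>
  transfer x x x (TMul TOne X) X (fun=> mul1r _).
have mulDl : left_distributive (@rs_mul M) (@rs_add M) := fun x y z =>
  transfer x y z (TMul (TAdd X Y) Z) (TAdd (TMul X Z) (TMul Y Z))
           (fun=> mulrDl _ _ _).
have neq01 : rs_one M <> rs_zero M.
  by apply: (MR (FNot (FEq TOne TZero))); apply/eqP/oner_neq0.
pose choiceM : choiceType :=
  HB.pack (rs_sort M) (gen_eqMixin M) (gen_choiceMixin M).
pose V : zmodType := HB.pack (rs_sort M) choiceM
  (GRing.isZmodule.Build choiceM addA addC add0 addN).
have one_neq0 : rs_one M != 0 :> V by apply/eqP.
pose S : comNzRingType := HB.pack (rs_sort M) V
  (GRing.Zmodule_isComNzRing.Build V mulA mulC mul1 mulDl one_neq0).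
by exists S; exact: rstruct_eta.
Qed.

Lemma models_theory_field (F : fieldType) (M : rstruct) :
  models_theory M (Th (ring_rstruct F)) ->
  exists K : fieldType, M = ring_rstruct K.
Proof.
move=> MF; have [S ME] := models_theory_comNzRing MF; rewrite {M}ME in MF *.
pose inv_formula : rformula 1 :=
  FEx (FAnd (FImp (FNot (FEq x1 TZero)) (FEq (TMul x0 x1) TOne))
            (FImp (FEq x1 TZero) (FEq x0 TZero))).
have inv_valid (v : 'I_1 -> ring_rstruct F) : sat inv_formula v.
  exists ((v ord0 : F)^-1); rewrite /= !env_consE; split=> [/eqP/mulVf // | ->].
  exact: invr0.
have /choice[inv invP] (x : S) :
    exists y, (x <> 0 -> y * x = 1) /\ (x = 0 -> y = 0).
  have [y] := models_theory_valid MF inv_valid (fun=> x).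
  by rewrite /= !env_consE; exists y.
have mulVx (x : S) : x != 0 -> inv x * x = 1 by move/eqP; case: (invP x).
have inv0 : inv 0 = 0 by case: (invP 0) => _; apply.
pose K : fieldType :=
  HB.pack (S : Type) S (GRing.ComNzRing_isField.Build S mulVx inv0).
by exists K.
Qed.

Lemma models_theory_pchar (R S : nzRingType) p :
  models_theory (ring_rstruct S) (Th (ring_rstruct R)) ->
  p \in [pchar R] -> p \in [pchar S].
Proof.
move=> SR /andP[p_prime /eqP p0]; rewrite inE p_prime; apply/eqP.
have : models (ring_rstruct S) (FEq (natr_term 0 p) TZero).
  by apply: SR; rewrite /Th /= /models /= teval_natr_term.
by rewrite /models /= teval_natr_term.
Qed.

Definition generator_formula p : rformula 1 :=
  FAnd (FNot (FEx (FEq (artin_schreier_term p x0) x1)))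
       (FAll (FEx (FEx (FAnd (FEq (exp_term x0 p) x0)
          (FEq x2 (TAdd (artin_schreier_term p x1) (TMul x0 x3))))))).

Lemma sat_generator_formula (R : comNzRingType) p (a : R) :
  @sat (ring_rstruct R) 1 (generator_formula p) (fun=> a) <->
  artin_schreier_generator p a.
Proof.
split=> -[a_notin spanned]; split.
- move=> [y _ ya]; apply: a_notin; exists y.
  by rewrite /= teval_exp_term /= !env_consE.
- move=> x; have [y [t]] := spanned x; rewrite /= !teval_exp_term /= !env_consE.
  by exists y, t.
- move=> [y]; rewrite /= teval_exp_term /= !env_consE => ya; apply: a_notin.
  by exists y.
- move=> x; have [y [t]] := spanned x; exists y, t.
  by rewrite /= !teval_exp_term /= !env_consE.
Qed.

(* In the variables [t, v, u, a], cleared of the denominator [v]. *)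
Definition coset_formula p : rformula 4 :=
  FEx (FEq (TMul x4 x3)
           (TMul x2 (TAdd (artin_schreier_term p x0) (TMul x1 x4)))).

Lemma sat_coset_formula (K : fieldType) p (t v u a : K) : v != 0 ->
  @sat (ring_rstruct K) 4 (coset_formula p)
       (env_cons t (env_cons v (env_cons u (fun=> a)))) <->
  range (artin_schreier p) (a * (u / v) - t * a).
Proof.
move=> nz_v; split=> [[y] | [y _ yE]].
  rewrite /= teval_exp_term /= !env_consE => yE; exists y => //.
  by rewrite mulrA yE [_ * (_ + _)]mulrC mulfK // addrK.
exists y; rewrite /= teval_exp_term /= !env_consE -/(artin_schreier p y) yE.
by rewrite subrK mulrCA [v * _]mulrC divfK.
Qed.

Lemma substruct_natr (R : pzRingType) (B : substruct (ring_rstruct R)) n :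
  ss_set B (n%:R : R).
Proof.
elim: n => [|n IHn]; first exact: (ss_zero B).
by rewrite -natr1; apply: (ss_add IHn (ss_one B)).
Qed.

Definition elem_map (M : rstruct) (B : set M) (s : set_type B -> set_type B) :=
  forall n (f : rformula n) (b : 'I_n -> set_type B),
    sat f (fun i => val (b i)) <-> sat f (fun i => val (s (b i))).

Section ElementaryMap.
Variables (K : fieldType) (p : nat) (B : substruct (ring_rstruct K)).
Hypothesis pcharK : p \in [pchar K].
Variable s : set_type B -> set_type B.
Hypothesis elem_s : elem_map s.

Local Notation value x := (val x : K).

Definition increment (x : set_type B) : set_type B :=
  in_subset (ss_add (set_mem (valP (s x))) (ss_opp (set_mem (valP x)))).

Lemma increment_comm x : s (increment x) = increment (s x).
Proof.
apply: val_inj => /=.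
have [+ _] := @elem_s 3 (FEq x0 (TAdd x1 (TOpp x2)))
  (env_cons (increment x) (env_cons (s x) (env_cons x (fun=> x)))).
by rewrite /= !env_consE; apply.
Qed.

Lemma elem_map_natr (t : set_type B) n : value t = n%:R -> s t = t.
Proof.
move=> tn; apply: val_inj.
have [+ _] := @elem_s 1 (FEq x0 (natr_term 1 n)) (fun=> t).
by rewrite /= !teval_natr_term => /(_ tn) ->.
Qed.

Lemma elem_map_unipotent_pair x :
  iter p s x = x -> s x <> x ->
  exists u v : set_type B,
    [/\ value v <> 0, s v = v & value (s u) = value u + value v].
Proof.
move=> spx sx.
apply: (@exists_unipotent_pair K (set_type B) s increment val _ _ p _ x) => //.
- by move=> y; rewrite increment_comm.
- by rewrite pnatE ?(pcharf_prime pcharK).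
- exact: val_inj.
Qed.

Lemma elem_map_coset (t v u a : set_type B) :
  s t = t -> s v = v -> s a = a -> value v != 0 ->
  range (artin_schreier p)
        (value a * (value u / value v) - value t * value a) ->
  range (artin_schreier p)
        (value a * (value (s u) / value v) - value t * value a).
Proof.
move=> st sv sa nz_v /(sat_coset_formula _ _ _ _ nz_v) sat_u.
apply/sat_coset_formula => //; have [+ _] := elem_s (coset_formula p)
  (env_cons t (env_cons v (env_cons u (fun=> a)))).
rewrite !(env_cons_comp val) !(env_cons_comp (fun x => val (s x))) st sv sa.
exact.
Qed.

Lemma elem_map_not_unipotent (a u v : set_type B) :
  artin_schreier_generator p (value a) ->
  s a = a -> value v <> 0 -> s v = v -> value (s u) <> value u + value v.
Proof.
move=> [a_notin spanned] sa /eqP nz_v sv su; apply: a_notin.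
have [y [t [/(pchar_fixed_natr pcharK)[n ->] cosetE]]] :=
  spanned (value a * (value u / value v)).
pose t0 : set_type B := in_subset (substruct_natr B n).
have t0_fixed : s t0 = t0 by apply: elem_map_natr.
have [|z _ zE] := @elem_map_coset t0 v u a t0_fixed sv sa nz_v.
  by exists y => //; rewrite cosetE addrK.
have {}zE : artin_schreier p z = artin_schreier p y + value a.
  by rewrite zE su mulrDl divff // mulrDr mulr1 cosetE addrAC addrK addrC.
by exists (z - y) => //; rewrite artin_schreierB // zE addrC addKr.
Qed.

End ElementaryMap.

Lemma elem_aut_isog_Zp_generator (M : rstruct) (A B : set M) p :
  (1 < p)%N -> elem_aut_isog_Zp A B p ->
  exists s : set_type B -> set_type B,
    [/\ elem_aut A s, forall x, iter p s x = x & exists x, s x <> x].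
Proof.
move=> p_gt1 [h [h_inj h_range hD]].
have h_aut i : @elem_aut M A B (h i) by rewrite -h_range; exists i.
have h0 x : h 0 x = x.
  have [[g gK _] _ _] := h_aut 0.
  by rewrite -[LHS]gK -[h 0 (h 0 x)]/((h 0 \o h 0) x) -hD addr0 gK.
have iter_h k x : iter k (h 1) x = h k%:R x.
  by elim: k => [|k IHk] /=; rewrite ?h0 // IHk -natr1 addrC hD.
exists (h 1); split=> [//|x|]; first by rewrite iter_h pchar_Zp.
apply: contrapT => h1_fixed; have /eqP := oner_neq0 'Z_p; apply; apply: h_inj.
apply/funext => x; rewrite h0; apply: contrapT => h1x.
by apply: h1_fixed; exists x.
Qed.

Theorem theorem8 (F : fieldType) (Fa : closedFieldType)
    (iota : {rmorphism F -> Fa}) (p : nat) :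
  is_algebraic_closure iota ->
  quasi_finite iota ->
  p \in [pchar F] ->
  ~ (max_abelian_pext Fa p `<=` range iota) ->
  ~ geometrically_represented (Th (ring_rstruct F)) p.
Proof.
move=> _ qfF pcharF ext_notin [M [M0 [A [B [MF M0M [M0A AB _] autB]]]]].
have p_gt1 := prime_gt1 (pcharf_prime pcharF).
have [K MK] := models_theory_field MF; subst M.
have pcharK := models_theory_pchar MF pcharF.
have [a0 gen_a0] := exists_artin_schreier_generator pcharF qfF ext_notin.
have [|a M0a /sat_generator_formula gen_a] :=
  elementary_substruct_witness (f := generator_formula p) M0M.
  apply: MF; exists a0; rewrite env_cons_empty; exact/sat_generator_formula.
have [s [[_ fixA elem_s] order_s [x sx]]] :=
  elem_aut_isog_Zp_generator p_gt1 autB.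
have [u [v [nz_v sv su]]] :=
  elem_map_unipotent_pair pcharK elem_s (order_s x) sx.
have Ba : ss_set B a := AB _ (M0A _ M0a).
have sa : s (in_subset Ba) = in_subset Ba by exact/fixA/M0A.
by apply: (elem_map_not_unipotent pcharK elem_s _ sa nz_v sv su); apply: gen_a.
Qed.
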